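(* Let $(\mathcal{N},O,M)$ be an NTS with observation modes, $\mathcal{N}=(S,A,T,s_{\mathrm{init}},AP,L)$, let $m_{\mathrm{init}}\in M$, let $\varphi$ be an scLTL formula over $AP$, and let $\mathcal{A}$ be a DFA accepting exactly the good finite prefixes of $\varphi$. Let $\mathcal{B}$ be the weighted belief product of $\mathcal{N}\times\mathcal{A}$ and let $C_{\mathcal{B}}$ be the strategy returned by Algorithm 1 on $\mathcal{B}$. Then the observation-based strategy $C$ for $(\mathcal{N},O,M)$ obtained from $C_{\mathcal{B}}$ (as defined in the context) is a solution to the optimal scLTL control problem: $C$ satisfies $\varphi$ starting from the configuration $(s_{\mathrm{init}},m_{\mathrm{init}})$, and $V(C,(s_{\mathrm{init}},m_{\mathrm{init}}),\varphi)$ is minimal among all observation-based strategies that satisfy $\varphi$ starting from $(s_{\mathrm{init}},m_{\mathrm{init}})$.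
   Context: An NTS is $\mathcal{N}=(S,A,T,s_{\mathrm{init}},AP,L)$ with $S$ nonempty finite, $A$ nonempty finite set of actions, $T:S\times A\to 2^S$, $s_{\mathrm{init}}\in S$, $AP$ atomic propositions, $L:S\to 2^{AP}$. An NTS with observation modes $(\mathcal{N},O,M)$ additionally has a nonempty finite set $O$ of observations and a nonempty finite set $M$ of modes, each $m\in M$ with $\gamma_m:S\to 2^O$ and cost $g_m\in\mathbb{R}_{\ge0}$. An observation-based strategy is a function $C:(2^O)^*\to A\times M$. A run under $C$ from configuration $(s,m)$ is $(s_0,m_0)(s_1,m_1)\dots$ with $(s_0,m_0)=(s,m)$ and, for all $i$, $(a_i,m_{i+1})=C(\gamma_{m_0}(s_0)\dots\gamma_{m_i}(s_i))$ and $s_{i+1}\in T(s_i,a_i)$. The cost of a finite run $(s_0,m_0)\dots(s_n,m_n)$ is $\sum_{i=0}^n g_{m_i}$. scLTL formulas over $AP$: $\varphi::=p\mid\neg p\mid\varphi\wedge\varphi\mid\varphi\vee\varphi\mid \mathbf{X}\varphi\mid\varphi\,\mathbf{U}\,\varphi\mid\mathbf{F}\varphi$ ($p\in AP$), with the usual LTL semantics over infinite words in $(2^{AP})^\omega$. A good finite prefix of $\varphi$ is a finite word all of whose infinite extensions satisfy $\varphi$. A run satisfies $\varphi$ if its label word $L(s_0)L(s_1)\dots$ satisfies $\varphi$, equivalently some finite prefix $(s_0,m_0)\dots(s_n,m_n)$ has $L(s_0)\dots L(s_n)$ a good prefix (such prefixes are called good prefixes of the run). $C$ satisfies $\varphi$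 from $(s,m)$ if every run under $C$ from $(s,m)$ satisfies $\varphi$. For such $C$, $V(C,(s,m),\varphi)=\max_{\rho}\min_{\rho^\varphi}g(\rho^\varphi)$, the max over runs $\rho$ under $C$ from $(s,m)$ and the min over good prefixes $\rho^\varphi$ of $\rho$, where $g$ is the cost above. DFA $\mathcal{A}=(Q,2^{AP},\delta,q_0,F)$, $\delta:Q\times2^{AP}\to Q$, accepting a finite word if the induced run ends in $F$. Product $\mathcal{P}=\mathcal{N}\times\mathcal{A}$: states $S\times Q$, $T_{\mathcal{P}}((s,q),a)=\{(s',\delta(q,L(s))):s'\in T(s,a)\}$, initial $(s_{\mathrm{init}},q_0)$, accepting $F_{\mathcal{P}}=\{(s,q):q\in F\}$; $\gamma_m((s,q)):=\gamma_m(s)$; $\mathrm{Post}(\mathbf{b},a)=\bigcup_{p\in\mathbf{b}}T_{\mathcal{P}}(p,a)$. Weighted belief product $\mathcal{B}$: belief states $\mathbf{B}$ = nonempty $\mathbf{b}\subseteq S\times Q$ on which some $\gamma_m$ is constant; actions $\mathbf{A}=A\times M$; $T_{\mathcal{B}}(\mathbf{b},(a,m'))$ = set of nonempty sets $\{p'\in\mathrm{Post}(\mathbf{b},a):\gamma_{m'}(p')=o\}$, $o\in2^O$; $\mathbf{b}_{\mathrm{init}}=\{(s_{\mathrm{init}},q_0)\}$; $F_{\mathcal{B}}=\{\mathbf{b}:\mathbf{b}\subseteq F_{\mathcal{P}}\}$; $w(\mathbf{b},(a,m))=g_m$. Algorithm 1 (input $\mathcal{B}$): $W_0:=F_{\mathcal{B}}$,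 $\mathrm{wtg}:=0$ on $W_0$ and $\infty$ elsewhere, $i:=1$. While $\mathbf{b}_{\mathrm{init}}\notin W_{i-1}$ and some $\mathbf{b}\in\mathbf{B}\setminus W_{i-1}$, $\mathbf{a}\in\mathbf{A}$ satisfy $\emptyset\ne T_{\mathcal{B}}(\mathbf{b},\mathbf{a})\subseteq W_{i-1}$: choose such a pair $(\mathbf{b}_{\min},\mathbf{a}_{\min})$ minimizing $\Delta=\max_{\mathbf{b}'\in T_{\mathcal{B}}(\mathbf{b},\mathbf{a})}\{w(\mathbf{b},\mathbf{a})+\mathrm{wtg}(\mathbf{b}')\}$ (minimum $\Delta_{\min}$); set $W_i:=W_{i-1}\cup\{\mathbf{b}_{\min}\}$, $C_{\mathcal{B}}(\mathbf{b}_{\min}):=\mathbf{a}_{\min}$, $\mathrm{wtg}(\mathbf{b}_{\min}):=\Delta_{\min}$, $i:=i+1$. If at the end $\mathbf{b}_{\mathrm{init}}$ is in the final $W$, return the partial map $C_{\mathcal{B}}:\mathbf{B}\to\mathbf{A}$; otherwise report that no strategy exists. The strategy $C$ obtained from $C_{\mathcal{B}}$: for an observation sequence $o_0o_1\dots o_n\in(2^O)^*$, let $\mathbf{b}_0=\mathbf{b}_{\mathrm{init}}$ and, for $i<n$, with $(a_i,m_{i+1})=C_{\mathcal{B}}(\mathbf{b}_i)$, let $\mathbf{b}_{i+1}=\{p'\in\mathrm{Post}(\mathbf{b}_i,a_i):\gamma_{m_{i+1}}(p')=o_{i+1}\}$ (the unique finite run of $\mathcal{B}$ corresponding to the observation sequence);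 set $C(o_0\dots o_n)=C_{\mathcal{B}}(\mathbf{b}_n)$ whenever this run exists (all these sets nonempty and $C_{\mathcal{B}}$ defined along it), and arbitrary otherwise.
   Formalization: Minimality is proved among satisfying strategies none of whose finite runs gets stuck in a state with no successor (all strategies if every T(s,a) is nonempty); otherwise the claim is false, since dead ends discard costly or failing runs. *)

(* Defs.v *)
From mathcomp Require Import boolp classical_sets reals constructive_ereal ereal.
From mathcomp Require Import all_boot all_order all_algebra.

Set Implicit Arguments.
Unset Strict Implicit.
Unset Printing Implicit Defensive.

Import Order.TTheory GRing.Theory Num.Theory.
Local Open Scope ring_scope.

(* AP may be infinite: nothing below depends on its cardinality. *)
Record nts (AP : Type) := NTS {
  state : finType;
  act : finType;
  trans : state -> act -> {set state};
  s_init : state;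
  label : state -> set AP;
  act_gt0 : (0 < #|act|)%N
}.

Record mnts (R : realType) (AP : Type) := MNTS {
  base :> nts AP;
  obs : finType;
  mode : finType;
  gamma : mode -> state base -> {set obs};
  cost : mode -> R;
  obs_gt0 : (0 < #|obs|)%N;
  mode_gt0 : (0 < #|mode|)%N;
  cost_ge0 : forall m, 0 <= cost m
}.

Inductive scltl (AP : Type) : Type :=
| Atom of AP
| NegAtom of AP
| And of scltl AP & scltl AP
| Or of scltl AP & scltl AP
| Next of scltl AP
| Until of scltl AP & scltl AP
| Finally of scltl AP.

Definition suffix_word (T : Type) (k : nat) (w : nat -> T) : nat -> T :=
  fun i => w (k + i)%N.

Fixpoint sat (AP : Type) (w : nat -> set AP) (phi : scltl AP) : Prop :=
  match phi with
  | Atom p => w 0%N p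
  | NegAtom p => ~ w 0%N p
  | And f g => sat w f /\ sat w g
  | Or f g => sat w f \/ sat w g
  | Next f => sat (suffix_word 1 w) f
  | Until f g => exists k, sat (suffix_word k w) g /\
      forall j, (j < k)%N -> sat (suffix_word j w) f
  | Finally f => exists k, sat (suffix_word k w) f
  end.

Definition cat_word (T : Type) (u : seq T) (w : nat -> T) : nat -> T :=
  fun i => nth (w (i - size u)%N) u i.

Definition good_prefix (AP : Type) (phi : scltl AP) (u : seq (set AP)) : Prop :=
  forall w : nat -> set AP, sat (cat_word u w) phi.

Record dfa (AP : Type) := DFA {
  dstate : finType;
  delta : dstate -> set AP -> dstate;
  q_init : dstate;
  final : {set dstate}
}.

Definition accepts (AP : Type) (D : dfa AP) (u : seq (set AP)) : bool :=
  foldl (@delta _ D) (q_init D) u \in final D.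

Section Runs.
Context (R : realType) (AP : Type) (N : mnts R AP).

Definition strategy := seq {set obs N} -> act N * mode N.
Definition config := (state N * mode N)%type.

Definition obs_upto (r : nat -> config) (n : nat) : seq {set obs N} :=
  mkseq (fun j => gamma (r j).2 (r j).1) n.+1.

Definition run_step (C : strategy) (r : nat -> config) (i : nat) : Prop :=
  let am := C (obs_upto r i) in
  (r i.+1).2 = am.2 /\ (r i.+1).1 \in trans (r i).1 am.1.

Definition is_run (C : strategy) (c : config) (r : nat -> config) : Prop :=
  r 0%N = c /\ forall i, run_step C r i.

Definition run_word (r : nat -> config) : nat -> set AP :=
  fun i => label (r i).1.

Definition satisfies (C : strategy) (c : config) (phi : scltl AP) : Prop :=
  forall r, is_run C c r -> sat (run_word r) phi.

Definition good_run_prefix (phi : scltl AP) (r : nat -> config) (n : nat) : Prop :=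
  good_prefix phi (mkseq (run_word r) n.+1).

Definition prefix_cost (r : nat -> config) (n : nat) : R :=
  \sum_(i < n.+1) cost (r i).2.

Definition run_value (phi : scltl AP) (r : nat -> config) : \bar R :=
  ereal_inf [set (prefix_cost r n)%:E | n in good_run_prefix phi r]%classic.

(* If C satisfies phi from c and has a run from c, then this supremum and the
   infima in it are attained: prefix costs are nondecreasing in n, and by
   Koenig's lemma good prefixes occur within a bound uniform over the runs. *)
Definition value (C : strategy) (c : config) (phi : scltl AP) : \bar R :=
  ereal_sup [set run_value phi r | r in is_run C c]%classic.

(* Runs are infinite, whereas trans s a may be empty.  A strategy is
   nonblocking from c if none of its finite runs from c gets stuck; this always
   holds when trans is total (total_nonblocking).  A strategy that is not
   nonblocking can discard costly or failing behaviours by driving them into a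
   dead end, where they no longer count as runs. *)
Definition nonblocking (C : strategy) (c : config) : Prop :=
  forall (r : nat -> config) (n : nat),
    r 0%N = c -> (forall i, (i < n)%N -> run_step C r i) ->
    exists s, s \in trans (r n).1 (C (obs_upto r n)).1.

Lemma total_nonblocking (C : strategy) (c : config) :
  (forall (s : state N) (a : act N), exists s', s' \in trans s a) ->
  nonblocking C c.
Proof. by move=> trans_total r n _ _; apply: trans_total. Qed.

End Runs.

Section BeliefProduct.
Context (R : realType) (AP : Type) (N : mnts R AP) (D : dfa AP).

Definition pstate : finType := (state N * dstate D)%type.

(* The automaton reads the label of the state being left. *)
Definition ptrans (p : pstate) (a : act N) : {set pstate} :=
  [set (s', delta p.2 (label p.1)) | s' in trans p.1 a].

Definition paccept : {set pstate} := [set p : pstate | p.2 \in final D].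

Definition Post (b : {set pstate}) (a : act N) : {set pstate} :=
  \bigcup_(p in b) ptrans p a.

Definition belief : {set {set pstate}} :=
  [set b : {set pstate} | (b != finset.set0) &&
    [exists m : mode N, forall p in b, forall p' in b,
       gamma m p.1 == gamma m p'.1]].

Definition observe (b : {set pstate}) (am : act N * mode N) (o : {set obs N}) :
    {set pstate} :=
  [set p' in Post b am.1 | gamma am.2 p'.1 == o].

Definition btrans (b : {set pstate}) (am : act N * mode N) :
    {set {set pstate}} :=
  [set observe b am o | o in [set: {set obs N}]] :\ finset.set0.

Definition b_init : {set pstate} := [set (s_init N, q_init D)].

Definition baccept : {set {set pstate}} :=
  [set b in belief | b \subset paccept].

Definition weight (b : {set pstate}) (am : act N * mode N) : R := cost am.2.

Definition bstrategy := {set pstate} -> option (act N * mode N).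

Record alg_state := AlgState {
  win : {set {set pstate}};
  wtg : {set pstate} -> \bar R;
  ctl : bstrategy
}.

Definition alg_start : alg_state := {|
  win := baccept;
  wtg := fun b => if b \in baccept then 0%E else +oo%E;
  ctl := fun=> None
|}.

Definition candidate (st : alg_state) (b : {set pstate})
    (am : act N * mode N) : bool :=
  [&& b \in belief :\: win st, btrans b am != finset.set0
    & btrans b am \subset win st].

Definition Delta (st : alg_state) (b : {set pstate})
    (am : act N * mode N) : \bar R :=
  \big[Order.max/-oo%E]_(b' in btrans b am) ((weight b am)%:E + wtg st b')%E.

Definition alg_update (st : alg_state) (b : {set pstate})
    (am : act N * mode N) : alg_state := {|
  win := b |: win st;
  wtg := fun b' => if b' == b then Delta st b am else wtg st b';
  ctl := fun b' => if b' == b then Some am else ctl st b'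
|}.

(* The states the loop can reach; ties between minimizers are broken
   arbitrarily. *)
Inductive alg_reach : alg_state -> Prop :=
| AlgStart : alg_reach alg_start
| AlgIter st b am :
    alg_reach st -> b_init \notin win st -> candidate st b am ->
    (forall b1 am1, candidate st b1 am1 -> (Delta st b am <= Delta st b1 am1)%E) ->
    alg_reach (alg_update st b am).

(* b_init \in win st is one of the exit conditions of the loop, so st is then
   the final state of an execution. *)
Definition alg_returns (CB : bstrategy) : Prop :=
  exists st, [/\ alg_reach st, b_init \in win st & CB = ctl st].

Definition bnext (CB : bstrategy) (b : {set pstate}) (o : {set obs N}) :
    option {set pstate} :=
  if CB b is Some am then
    let b' := observe b am o in if b' == finset.set0 then None else Some b'
  else None.

(* The last belief of the run of CB matching the observations o_1 ... o_n that
   follow the initial one, if that run exists. *)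
Definition brun (CB : bstrategy) (os : seq {set obs N}) : option {set pstate} :=
  foldl (fun ob o => obind (fun b => bnext CB b o) ob) (Some b_init) os.

Definition obtained_from (CB : bstrategy) (C : strategy N) : Prop :=
  forall o0 os b am,
    brun CB os = Some b -> CB b = Some am -> C (o0 :: os) = am.

End BeliefProduct.

(* Main.v *)
(* Writing g_0 for the cost of a cheapest mode, a strategy C' that satisfies phi
   with value V yields, by Koenig's lemma, a belief tree of bounded depth all of
   whose branches cost at most V + g_0 - cost m_init: every nonaccepting product
   state of a belief is reached by an actual run with the same observations,
   which cannot have had a good prefix yet.  The Dijkstra-type invariant says
   that wtg is at most the cost of any such tree rooted at a settled belief.
   Conversely, a run under C decreases wtg by the cost of each mode entered, so
   it has a good prefix of cost at most cost m_init + wtg b_init - g_0: the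
   automaton accepts one step after the good prefix, hence the last mode entered
   is not paid for. *)

Require Import Defs.
From mathcomp Require Import boolp classical_sets reals constructive_ereal ereal.
From mathcomp Require Import all_boot all_order all_algebra.
From mathcomp Require Import lra zify.

Set Implicit Arguments.
Unset Strict Implicit.
Unset Printing Implicit Defensive.

Import Order.TTheory GRing.Theory Num.Theory.
Local Open Scope ring_scope.

(** * Co-safety: satisfaction is decided by finite prefixes *)

(** Negation occurs only on atoms and there is no always operator, so a satisfied formula is
    witnessed at finitely many positions. For [Until], the horizons of the finitely many positions
    before [k] are combined by induction on [k]. *)
Lemma sat_local (AP : Type) (phi : scltl AP) (w : nat -> set AP) :
  sat w phi ->
  exists n, forall w', (forall i, (i < n)%N -> w' i = w i) -> sat w' phi.
Proof.
elim: phi w => [p|p|f IHf g IHg|f IHf g IHg|f IHf|f IHf g IHg|f IHf] w /=.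
- by move=> wp; exists 1%N => w' ->.
- by move=> wp; exists 1%N => w' ->.
- case=> /IHf[n Hn] /IHg[m Hm]; exists (maxn n m) => w' Hw.
  by split; [apply: Hn => i ? | apply: Hm => i ?]; apply: Hw; lia.
- by case=> [/IHf|/IHg] [n Hn]; exists n => w' /Hn; [left|right].
- move=> /IHf[n Hn]; exists n.+1 => w' Hw; apply: Hn => i ?.
  by apply: Hw; lia.
- case=> k [/IHg[n Hn] Hf].
  have [N HN] : exists N, forall w', (forall i, (i < N)%N -> w' i = w i) ->
      forall j, (j < k)%N -> sat (suffix_word j w') f.
    elim: k Hf {n Hn} => [|k IHk] Hf; first by exists 0%N.
    have [|N HN] := IHk; first by move=> j ?; apply: Hf; lia.
    have [n Hn] := IHf _ (Hf k (ltnSn k)).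
    exists (maxn N (k + n)) => w' Hw j; rewrite ltnS leq_eqVlt => /orP[/eqP->|jk].
      by apply: Hn => i ?; apply: Hw; lia.
    by apply: HN => // i ?; apply: Hw; lia.
  exists (maxn N (k + n)) => w' Hw; exists k; split.
    by apply: Hn => i ?; apply: Hw; lia.
  by apply: HN => i ?; apply: Hw; lia.
- case=> k /IHf[n Hn]; exists (k + n)%N => w' Hw; exists k.
  by apply: Hn => i ?; apply: Hw; lia.
Qed.

Lemma sat_good_prefix (AP : Type) (phi : scltl AP) (w : nat -> set AP) :
  sat w phi -> exists n, good_prefix phi (mkseq w n).
Proof.
move=> /sat_local[n Hn]; exists n => w'; apply: Hn => i lt_in.
by rewrite /cat_word (set_nth_default (w i)) ?size_mkseq // nth_mkseq.
Qed.

Lemma good_prefix_sat (AP : Type) (phi : scltl AP) (w : nat -> set AP) n :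
  good_prefix phi (mkseq w n) -> sat w phi.
Proof.
move=> /(_ (suffix_word n w)); congr sat; apply/funext => i.
rewrite /cat_word size_mkseq; have [lt_in|le_ni] := ltnP i n.
  by rewrite (set_nth_default (w i)) ?size_mkseq // nth_mkseq.
by rewrite nth_default ?size_mkseq // /suffix_word subnKC.
Qed.

Lemma good_prefix_cat (AP : Type) (phi : scltl AP) (u v : seq (set AP)) :
  good_prefix phi u -> good_prefix phi (u ++ v).
Proof.
move=> good_u w; move: (good_u (cat_word v w)); congr sat; apply/funext => i.
rewrite /cat_word nth_cat size_cat; have [lt_iu|le_ui] := ltnP i (size u).
  exact: set_nth_default.
by rewrite nth_default // subnDA.
Qed.

(** * Dependent choice and Koenig's lemma *)

(** The iterated extensions [g n] are nested, so reading entry [i] off a stage long enough to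
    contain it gives a consistent limit. *)
Lemma dependent_choice_seq (T : Type) (P : seq T -> Prop) (s : seq T) (x0 : T) :
  P s -> (forall s', P s' -> exists x, P (rcons s' x)) ->
  exists r : nat -> T, (forall i, (i < size s)%N -> r i = nth x0 s i) /\
    forall n, (size s <= n)%N -> P (mkseq r n).
Proof.
move=> Ps step.
have /choice[f Hf] : forall s', exists x, P s' -> P (rcons s' x).
  move=> s'.
  have [Ps'|nPs'] := pselect (P s'); last by exists x0.
  by have [x Hx] := step _ Ps'; exists x.
pose g n := iter n (fun s' => rcons s' (f s')) s.
have Pg n : P (g n) by elim: n => //= n; apply: Hf.
have size_g n : size (g n) = (size s + n)%N.
  by elim: n => [|n IHn]; rewrite ?addn0 //= size_rcons IHn addnS.
have nth_g i n m : (i < size (g n))%N -> nth x0 (g (n + m)%N) i = nth x0 (g n) i.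
  elim: m => [|m IHm] lt_i; first by rewrite addn0.
  rewrite addnS [g _]/(rcons (g _) _) nth_rcons IHm // ifT //.
  by move: lt_i; rewrite !size_g; lia.
exists (fun i => nth x0 (g i.+1) i); split=> [i lt_is|n le_sn].
  by rewrite (nth_g _ 0%N) ?size_g ?addn0.
suff -> : mkseq (fun i => nth x0 (g i.+1) i) n = g (n - size s)%N by [].
apply: (@eq_from_nth _ x0) => [|i]; first by rewrite size_mkseq size_g; lia.
rewrite size_mkseq => lt_in; rewrite nth_mkseq //.
have [le|le] := leqP i.+1 (n - size s).
  by rewrite -(subnKC le) nth_g // size_g; lia.
by rewrite -[in LHS](subnKC (ltnW le)) nth_g // size_g; lia.
Qed.

(** A list is [long] if witnesses of every level start with it. As [T] is finite, a long list has a
    long one-letter extension. *)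
Lemma koenig (T : finType) (x0 : T) (P : nat -> (nat -> T) -> Prop) :
  (forall n r r', (forall i, (i <= n)%N -> r i = r' i) -> P n r -> P n r') ->
  (forall n r, P n.+1 r -> P n r) ->
  (forall n, exists r, P n r) ->
  exists r, forall n, P n r.
Proof.
move=> P_ext P_dec P_ex.
have P_le m n r : (n <= m)%N -> P m r -> P n r.
  by move=> /subnK<-; elim: (m - n)%N => // k IHk /P_dec.
pose long s := forall n, exists2 r, P n r & mkseq r (size s) = s.
have [||r [_ r_long]] := @dependent_choice_seq _ long [::] x0.
- by move=> n; have [r ?] := P_ex n; exists r.
- move=> s long_s; apply: contrapT => /forallNP no_ext.
  have /choice[h Hh] : forall x, exists n,
      ~ exists2 r, P n r & mkseq r (size (rcons s x)) = rcons s x.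
    by move=> x; have /existsNP := no_ext x.
  (* [h x] is a level at which appending [x] fails; a witness at the largest of these levels refutes
     the failure for its own next letter. *)
  have [r Pr r_s] := long_s (\max_x h x).
  apply: (Hh (r (size s))); exists r; last by rewrite size_rcons mkseqS r_s.
  by apply: P_le Pr; apply: leq_bigmax.
exists r => n; have [r' Pr' r'_r] := r_long n.+1 isT n.
apply: P_ext Pr' => i le_in; move/(congr1 (fun s => nth x0 s i)): r'_r.
by rewrite size_mkseq !nth_mkseq.
Qed.

(** * Soundness and optimality of the algorithm on beliefs *)

Section Algorithm.
Context (R : realType) (AP : Type) (N : mnts R AP) (D : dfa AP).
Notation belief_set := {set pstate N D}.
Implicit Types (b : belief_set) (am : act N * mode N) (st : alg_state N D).

Lemma observe_belief b am o :
  observe b am o != finset.set0 -> observe b am o \in belief N D.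
Proof.
move=> ne; rewrite inE ne; apply/existsP; exists am.2.
apply/forallP => p; apply/implyP; rewrite inE => /andP[_ /eqP->].
by apply/forallP => p'; apply/implyP; rewrite inE => /andP[_ /eqP->].
Qed.

Lemma mem_btransP b am b' :
  reflect (exists2 o, b' = observe b am o & b' != finset.set0)
          (b' \in btrans b am).
Proof.
rewrite !inE; apply: (iffP andP) => [[ne /imsetP[o _ def_b']]|[o -> ne]].
  by exists o.
by split=> //; apply/imsetP; exists o.
Qed.

Definition legal b am : Prop := b \in belief N D /\ btrans b am != finset.set0.

(** A finite tree of moves allowed by [ok], with accepting leaves and budget [v] for every branch.
    Taking [ok] to be [legal] gives all trees; taking it to be a partial map gives the tree which
    that map plays. *)
Inductive wins (ok : belief_set -> act N * mode N -> Prop) :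
    belief_set -> R -> Prop :=
| WinsAccept b v : b \in baccept N D -> 0 <= v -> wins ok b v
| WinsMove b am v : ok b am ->
    (forall b', b' \in btrans b am -> wins ok b' (v - cost am.2)) ->
    wins ok b v.

Lemma wins_le ok b v v' : wins ok b v -> v <= v' -> wins ok b v'.
Proof.
move=> w; elim: {b v}w v' => [b v acc v0|b am v okb _ IH] v' le_v.
  by apply: WinsAccept => //; apply: le_trans le_v.
by apply: WinsMove okb _ => b' /IH; apply; rewrite lerD2r.
Qed.

Lemma wins_sub (ok ok' : belief_set -> act N * mode N -> Prop) b v :
  (forall b am, ok b am -> ok' b am) -> wins ok b v -> wins ok' b v.
Proof.
move=> sub w; elim: w => [b' v' acc v0|b' am v' /sub okb _ IH].
  exact: WinsAccept.
exact: WinsMove okb IH.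
Qed.

(** A legal move has a successor, so some branch reaches a leaf, where the budget is nonnegative;
    going back up only adds nonnegative costs. *)
Lemma wins_legal_ge0 b v : wins legal b v -> 0 <= v.
Proof.
elim=> // {}b am {}v [_ /finset.set0Pn[b' b'_in]] _ /(_ _ b'_in).
by rewrite subr_ge0; apply: le_trans; apply: cost_ge0.
Qed.

Lemma Delta_ge st b am b' : b' \in btrans b am ->
  ((cost am.2)%:E + wtg st b' <= Delta st b am)%E.
Proof. exact: le_bigmax_cond. Qed.

Lemma Delta_le st b am (v : R) :
  (forall b', b' \in btrans b am -> ((cost am.2)%:E + wtg st b' <= v%:E)%E) ->
  (Delta st b am <= v%:E)%E.
Proof. by move=> le_v; apply/bigmax_leP; split=> //; rewrite leNye. Qed.

Lemma ctl_win st b am : alg_reach st -> ctl st b = Some am -> b \in win st.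
Proof.
move=> r; elim: r b am => //= {}st b am _ IH _ _ _ b' am'.
by rewrite in_setU1; case: eqP => //= _ /IH.
Qed.

(** Successors of a settled nonaccepting belief were settled before it, so the moves of [ctl] form a
    finite tree. *)
Lemma alg_sound st b : alg_reach st -> b \in win st ->
  exists2 v, wtg st b = v%:E & wins (fun b am => ctl st b = Some am) b v.
Proof.
move=> r; elim: r b => [|{}st b am r IH _ cand _] b' /=.
  by move=> acc; exists 0; [rewrite acc | apply: WinsAccept].
have /and3P[/finset.setDP[b_bel b_nwin] ne sub] := cand.
(* The update changes [ctl] only at [b], which was unsettled and hence without a move, so older
   trees survive. *)
have ctl_ext b1 v : wins (fun b am => ctl st b = Some am) b1 v ->
    wins (fun b' am' => (if b' == b then Some am else ctl st b') = Some am')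
      b1 v.
  apply: wins_sub => b2 am2 ctl2; case: eqP => // b2b.
  by move: b_nwin; rewrite -b2b (ctl_win r ctl2).
rewrite in_setU1; case: eqP => /= [->{b'}|_ b'_win]; last first.
  by have [v wtgv /ctl_ext] := IH _ b'_win; exists v.
have D_fin : Delta st b am \is a fin_num.
  rewrite fin_numElt; apply/andP; split.
    have [b1 b1_in] := finset.set0Pn _ ne.
    apply: lt_le_trans (Delta_ge st b1_in).
    by have [v -> _] := IH _ (fintype.subsetP sub _ b1_in); rewrite -EFinD ltNyr.
  apply/bigmax_ltP; split=> [|b1 b1_in]; first by [].
  by have [v -> _] := IH _ (fintype.subsetP sub _ b1_in); rewrite -EFinD ltry.
exists (fine (Delta st b am)); first by rewrite fineK.
apply: (@WinsMove _ _ am); first by rewrite eqxx.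
move=> b1 b1_in; apply: ctl_ext.
have [v wtgv /wins_le] := IH _ (fintype.subsetP sub _ b1_in); apply.
by rewrite lerBrDl -lee_fin EFinD -wtgv fineK // Delta_ge.
Qed.

(* A win from an unsettled belief has to leave the unsettled beliefs somewhere;
   costs being nonnegative, the candidate used there is no dearer. *)
Lemma wins_candidate st b v :
  (forall b' v', b' \in win st -> wins legal b' v' -> (wtg st b' <= v'%:E)%E) ->
  baccept N D \subset win st ->
  wins legal b v -> b \notin win st ->
  exists b1 am1, candidate st b1 am1 /\ (Delta st b1 am1 <= v%:E)%E.
Proof.
move=> opt acc_win; elim=> {b v}[b v acc _|b am v [b_bel ne] wins_next IH] b_nwin.
  by rewrite (fintype.subsetP acc_win) in b_nwin.
have [sub|/fintype.subsetPn[b' b'_in b'_nwin]] := boolP (btrans b am \subset win st).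
  exists b, am; split; first by rewrite /candidate in_setD b_nwin b_bel ne.
  apply: Delta_le => b' b'_in.
  rewrite -[v](subrKC (cost am.2)) EFinD leeD2l //.
  exact: opt (fintype.subsetP sub _ b'_in) (wins_next _ b'_in).
have [b1 [am1 [cand le_v]]] := IH _ b'_in b'_nwin.
exists b1, am1; split=> //; apply: le_trans le_v _.
by rewrite lee_fin gerBl cost_ge0.
Qed.

Lemma baccept_win st : alg_reach st -> baccept N D \subset win st.
Proof.
by elim=> //= {}st b am _ sub _ _ _; apply: fintype.subset_trans sub (finset.subsetUr _ _).
Qed.

(** When [b] is settled, any win from it yields a candidate with [Delta] at most [v], and the chosen
    pair minimizes [Delta]. *)
Lemma alg_optimal st b v : alg_reach st -> b \in win st -> wins legal b v ->
  (wtg st b <= v%:E)%E.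
Proof.
move=> r; elim: r b v => [|{}st b am r IH _ cand min_cand] b' v /=.
  by move=> acc /wins_legal_ge0 v0; rewrite acc lee_fin.
rewrite in_setU1; case: eqP => /= [->{b'} _ w|_]; last exact: IH.
have /and3P[/finset.setDP[_ b_nwin] _ _] := cand.
have [b1 [am1 [/min_cand le1 le2]]] := wins_candidate IH (baccept_win r) w b_nwin.
exact: le_trans le1 le2.
Qed.

End Algorithm.

(** * Finite runs, product runs and beliefs along a run *)

Section Runs.
Context (R : realType) (AP : Type) (N : mnts R AP) (D : dfa AP).
Implicit Types (r : nat -> config N) (n : nat).

(** Only the labels before position [n] have been read, matching [ptrans]; a good prefix ending at
    [n] therefore shows at index [n.+1]. *)
Definition dfa_run r n : dstate D :=
  foldl (@delta _ D) (q_init D) (mkseq (run_word r) n).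

Definition product_run r n : pstate N D := ((r n).1, dfa_run r n).

Lemma dfa_runS r n : dfa_run r n.+1 = delta (dfa_run r n) (label (r n).1).
Proof. by rewrite /dfa_run mkseqS foldl_rcons. Qed.

Lemma prefix_cost0 r : prefix_cost r 0 = cost (r 0%N).2.
Proof. by rewrite /prefix_cost big_ord1. Qed.

Lemma prefix_costS r n :
  prefix_cost r n.+1 = prefix_cost r n + cost (r n.+1).2.
Proof. by rewrite /prefix_cost big_ord_recr. Qed.

Lemma prefix_cost_le r n k : (n <= k)%N -> prefix_cost r n <= prefix_cost r k.
Proof.
move=> /subnK<-; elim: (k - n)%N => // j IHj.
by rewrite addSn prefix_costS ler_wpDr ?cost_ge0.
Qed.

Lemma eq_obs_upto r r' n i : obs_upto r n = obs_upto r' n -> (i <= n)%N ->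
  obs_upto r i = obs_upto r' i.
Proof.
move=> eq_obs le_in; have: take i.+1 (obs_upto r n) = take i.+1 (obs_upto r' n).
  by rewrite eq_obs.
by rewrite -!map_take !take_iota (minn_idPl _).
Qed.

Lemma eq_last_obs r r' n : obs_upto r n = obs_upto r' n ->
  gamma (r n).2 (r n).1 = gamma (r' n).2 (r' n).1.
Proof. by rewrite /obs_upto !mkseqS => /rcons_inj[]. Qed.

Lemma obs_uptoS r n :
  obs_upto r n.+1 = rcons (obs_upto r n) (gamma (r n.+1).2 (r n.+1).1).
Proof. by rewrite /obs_upto mkseqS. Qed.

Lemma obs_upto_ext r r' n : (forall i, (i <= n)%N -> r i = r' i) ->
  obs_upto r n = obs_upto r' n.
Proof.
move=> eq_r; apply/eq_in_map => i; rewrite mem_iota ltnS => le_in.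
by rewrite eq_r.
Qed.

Lemma dfa_run_ext r r' n : (forall i, (i < n)%N -> r i = r' i) ->
  dfa_run r n = dfa_run r' n.
Proof.
move=> eq_r; congr foldl; apply/eq_in_map => i; rewrite mem_iota => lt_in.
by rewrite /run_word eq_r.
Qed.

Lemma mem_observe (b : {set pstate N D}) am p :
  p \in Post b am.1 -> p \in observe b am (gamma am.2 p.1).
Proof. by move=> pb; rewrite inE pb eqxx. Qed.

Lemma mem_observe_step (C : strategy N) (b : {set pstate N D}) r n :
  product_run r n \in b -> run_step C r n ->
  product_run r n.+1 \in
    observe b (C (obs_upto r n)) (gamma (r n.+1).2 (r n.+1).1).
Proof.
move=> pb [eq_mode s_next]; rewrite eq_mode; apply: mem_observe.
apply/bigcupP; exists (product_run r n) => //.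
by apply/imsetP; exists (r n.+1).1; rewrite // /product_run dfa_runS.
Qed.

Section Strategy.
Context (C : strategy N) (c : config N).

(** A finite run is kept as a total function whose values after [n] are irrelevant. *)
Definition run_upto n r := r 0%N = c /\ forall i, (i < n)%N -> run_step C r i.

Lemma run_upto_le n k r : (n <= k)%N -> run_upto k r -> run_upto n r.
Proof. by move=> le_nk [r0 step]; split=> // i lt_in; apply: step; lia. Qed.

Lemma run_step_ext r r' n : (forall i, (i <= n.+1)%N -> r i = r' i) ->
  run_step C r n -> run_step C r' n.
Proof.
move=> eq_r; rewrite /run_step -!eq_r // (@obs_upto_ext r r') // => i le_in.
by apply: eq_r; lia.
Qed.

Lemma run_upto_ext r r' n : (forall i, (i <= n)%N -> r i = r' i) ->
  run_upto n r -> run_upto n r'.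
Proof.
move=> eq_r [r0 step]; split=> [|i lt_in]; first by rewrite -eq_r.
by apply: run_step_ext (step i lt_in) => j le_j; apply: eq_r; lia.
Qed.

(** Every mode after the first is chosen by [C] from the observations, so runs with equal
    observations enter equal modes. *)
Lemma eq_prefix_cost r r' n : run_upto n r -> run_upto n r' ->
  obs_upto r n = obs_upto r' n -> prefix_cost r n = prefix_cost r' n.
Proof.
move=> [r0 step] [r'0 step'] eq_obs; apply: eq_bigr => -[[|i] lt_i] _ /=.
  by rewrite r0 r'0.
have [-> _] := step _ lt_i; have [-> _] := step' _ lt_i.
by rewrite (eq_obs_upto eq_obs) // ltnW.
Qed.

Lemma run_upto_snoc r n (s : state N) : run_upto n r ->
  s \in trans (r n).1 (C (obs_upto r n)).1 ->
  exists r', [/\ run_upto n.+1 r', forall i, (i <= n)%N -> r i = r' i &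
    r' n.+1 = (s, (C (obs_upto r n)).2)].
Proof.
move=> run_r s_next.
pose r' i := if (i <= n)%N then r i else (s, (C (obs_upto r n)).2).
have eq_r i : (i <= n)%N -> r i = r' i by rewrite /r' => ->.
have r'S : r' n.+1 = (s, (C (obs_upto r n)).2) by rewrite /r' ltnn.
exists r'; split=> //; have [r'0 step] := run_upto_ext eq_r run_r.
split=> // i; rewrite ltnS leq_eqVlt => /orP[/eqP->|/step//].
by rewrite /run_step r'S -(obs_upto_ext eq_r) -eq_r.
Qed.

Lemma run_upto_extend r n : nonblocking C c -> run_upto n r ->
  exists2 r', is_run C c r' & forall i, (i <= n)%N -> r i = r' i.
Proof.
move=> nb run_r.
(* Nonempty lists code finite runs: a run with no step already has one configuration. *)
pose P s := (0 < size s)%N /\ run_upto (size s).-1 (nth c s).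
have nth_r i : (i <= n)%N -> r i = nth c (mkseq r n.+1) i.
  by move=> le_in; rewrite nth_mkseq.
have [||r' [r'_r r'P]] := @dependent_choice_seq _ P (mkseq r n.+1) c.
- by split; rewrite size_mkseq //; apply: run_upto_ext run_r.
- move=> s [s_gt0 run_s]; have [s' s'_next] := nb _ _ run_s.1 run_s.2.
  have [r1 [run_r1 eq_r1 r1S]] := run_upto_snoc run_s s'_next.
  exists (r1 (size s)); split; rewrite size_rcons //=.
  rewrite prednK // in run_r1.
  apply: run_upto_ext run_r1 => i le_i; rewrite nth_rcons.
  by case: ltngtP le_i => [lt_i _|//|-> //]; rewrite -eq_r1 //; lia.
exists r' => [|i le_in]; last first.
  by rewrite r'_r ?size_mkseq // nth_r.
have run_r' k : run_upto k r'.
  have [|_] := r'P (k + n).+1; first by rewrite size_mkseq; lia.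
  rewrite size_mkseq /= => /(run_upto_le (leq_addr n k)).
  by apply: run_upto_ext => i le_ik; rewrite nth_mkseq //; lia.
by split=> [|i]; [have [] := run_r' 0%N | have [_] := run_r' i.+1; apply].
Qed.

(** The moves come from the history-dependent [C], so this is a path in the belief product that need
    not follow a memoryless strategy. *)
Fixpoint belief_run r n : {set pstate N D} :=
  if n is n'.+1 then
    observe (belief_run r n') (C (obs_upto r n')) (gamma (r n).2 (r n).1)
  else [set (c.1, q_init D)].

Lemma eq_belief_run r r' n : obs_upto r n = obs_upto r' n ->
  belief_run r n = belief_run r' n.
Proof.
elim: n => //= n IHn eq_obs.
by rewrite (eq_last_obs eq_obs) (eq_obs_upto eq_obs) // IHn // (eq_obs_upto eq_obs).
Qed.

Lemma mem_belief_run r n : run_upto n r -> product_run r n \in belief_run r n.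
Proof.
elim: n => [|n IHn] run_r; first by rewrite inE /product_run run_r.1.
apply: mem_observe_step; last by apply: run_r.2.
exact: IHn (run_upto_le (leqnSn n) run_r).
Qed.

Lemma belief_runS_ext r r' n : obs_upto r' n = obs_upto r n ->
  (r' n.+1).2 = (C (obs_upto r n)).2 ->
  belief_run r' n.+1 = observe (belief_run r n) (C (obs_upto r n))
    (gamma (C (obs_upto r n)).2 (r' n.+1).1).
Proof. by move=> eq_obs /= ->; rewrite (eq_belief_run eq_obs) eq_obs. Qed.

Lemma product_run_snoc r n p : run_upto n r ->
  p \in ptrans (product_run r n) (C (obs_upto r n)).1 ->
  exists r', [/\ run_upto n.+1 r', obs_upto r' n = obs_upto r n,
    product_run r' n.+1 = p & (r' n.+1).2 = (C (obs_upto r n)).2].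
Proof.
move=> run_r /imsetP[s s_next ->].
have [r' [run_r' eq_r r'S]] := run_upto_snoc run_r s_next.
exists r'; split=> //; rewrite ?r'S //; first by rewrite (obs_upto_ext eq_r).
rewrite /product_run dfa_runS r'S /= -eq_r // (@dfa_run_ext r' r) // => i lt_in.
by rewrite eq_r // ltnW.
Qed.

(** A predecessor of [p] in the previous belief is realized by induction, and one more step with the
    same action and mode reaches [p] with the required observation. *)
Lemma belief_run_realized r n p : run_upto n r -> p \in belief_run r n ->
  exists r', [/\ run_upto n r', obs_upto r' n = obs_upto r n &
    product_run r' n = p].
Proof.
elim: n p => [|n IHn] p run_r.
  by rewrite inE => /eqP->; exists r; split=> //; rewrite /product_run run_r.1.
rewrite inE => /andP[/bigcupP[p0 p0_in p_next] /eqP obs_p].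
have [r1 [run_r1 eq_r1 r1p0]] := IHn _ (run_upto_le (leqnSn n) run_r) p0_in.
rewrite -r1p0 -eq_r1 in p_next.
have [r2 [run_r2 eq_r2 r2p mode_r2]] := product_run_snoc run_r1 p_next.
exists r2; split=> //; rewrite !obs_uptoS eq_r2 eq_r1; congr rcons.
by rewrite mode_r2 eq_r1 -obs_p -r2p.
Qed.

Lemma belief_run_step r n p : run_upto n r ->
  p \in Post (belief_run r n) (C (obs_upto r n)).1 ->
  exists r', [/\ run_upto n.+1 r', product_run r' n.+1 = p,
    prefix_cost r' n.+1 = prefix_cost r n + cost (C (obs_upto r n)).2 &
    belief_run r' n.+1 = observe (belief_run r n) (C (obs_upto r n))
      (gamma (C (obs_upto r n)).2 p.1)].
Proof.
move=> run_r /bigcupP[p0 p0_in p_next].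
have [r1 [run_r1 eq_r1 r1p0]] := belief_run_realized run_r p0_in.
rewrite -r1p0 -eq_r1 in p_next.
have [r2 [run_r2 eq_r2 r2p mode_r2]] := product_run_snoc run_r1 p_next.
rewrite eq_r1 in eq_r2 mode_r2.
exists r2; split=> //; last by rewrite (belief_runS_ext eq_r2) // -r2p.
rewrite prefix_costS mode_r2 (eq_prefix_cost _ run_r eq_r2) //.
exact: run_upto_le run_r2.
Qed.

Lemma belief_run_belief r n : run_upto n r -> belief_run r n \in belief N D.
Proof.
case: n => [|n] run_r; last first.
  apply: observe_belief; apply/finset.set0Pn.
  by exists (product_run r n.+1); apply: mem_belief_run.
rewrite inE; apply/andP; split.
  by apply/finset.set0Pn; exists (c.1, q_init D); rewrite inE.
apply/existsP; exists c.2; apply/forallP => p; apply/implyP.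
rewrite inE => /eqP->.
by apply/forallP => p'; apply/implyP; rewrite inE => /eqP->.
Qed.

End Strategy.

(** * Comparison of strategies with winning trees of beliefs *)

Context (phi : scltl AP)
  (D_good : forall u : seq (set AP), accepts D u <-> good_prefix phi u).

Lemma good_run_prefixE r n :
  good_run_prefix phi r n <-> dfa_run r n.+1 \in final D.
Proof. exact: iff_sym (D_good _). Qed.

Lemma dfa_run_final_le r n k : (n <= k)%N ->
  dfa_run r n \in final D -> dfa_run r k \in final D.
Proof.
move=> /subnKC<- /D_good good; apply/D_good.
by rewrite /mkseq iotaD map_cat; apply: good_prefix_cat.
Qed.

(** Otherwise Koenig's lemma turns arbitrarily long nonaccepted finite runs into an infinite run
    without good prefix. *)
Lemma satisfies_horizon (C : strategy N) (c : config N) : satisfies C c phi ->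
  exists h, forall r n, run_upto C c n r -> (h <= n)%N ->
    dfa_run r n \in final D.
Proof.
move=> C_sat; apply: contrapT => /forallNP no_h.
pose P n r := run_upto C c n r /\ dfa_run r n \notin final D.
have [|||r Pr] := @koenig (state N * mode N)%type c P.
- move=> n r r' eq_r [run_r nfin]; split; first exact: run_upto_ext run_r.
  by rewrite -(@dfa_run_ext r) // => i lt_in; apply: eq_r; apply: ltnW.
- move=> n r [run_r nfin]; split; first exact: run_upto_le run_r.
  by apply: contra nfin; apply: dfa_run_final_le.
- move=> h; have /existsNP[r /existsNP[n]] := no_h h.
  move=> /not_implyP[run_r /not_implyP[le_hn nfin]].
  exists r; split; first exact: run_upto_le run_r.
  by apply/negP => fin; apply: nfin; apply: dfa_run_final_le fin.
have run_r : is_run C c r.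
  by split=> [|i]; [have [[]] := Pr 0%N | have [[_ +] _] := Pr i.+1; apply].
have [n /D_good] := sat_good_prefix (C_sat _ run_r).
by have [_ /negP] := Pr n.
Qed.

(** Nonblocking extends the finite run to an infinite one; its good prefixes all end at [n] or
    later, and prefix costs are nondecreasing. *)
Lemma value_ge (C : strategy N) (c : config N) r n : nonblocking C c ->
  run_upto C c n r ->
  (forall k, (k < n)%N -> dfa_run r k.+1 \notin final D) ->
  ((prefix_cost r n)%:E <= value C c phi)%E.
Proof.
move=> nb run_r not_good; have [r' run_r' eq_r] := run_upto_extend nb run_r.
apply: le_ereal_sup_tmp; exists (run_value phi r'); first by exists r'.
apply: le_ereal_inf_tmp => _ [k /good_run_prefixE good <-]; rewrite lee_fin.
have -> : prefix_cost r n = prefix_cost r' n.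
  by apply: eq_bigr => i _; rewrite eq_r // -ltnS.
apply: prefix_cost_le; rewrite leqNgt; apply/negP => lt_kn.
case/negP: (not_good _ lt_kn); rewrite (@dfa_run_ext r r') // => i le_ik.
by apply: eq_r; lia.
Qed.

Lemma value_ge_nonfinal (C : strategy N) (c : config N) r n : nonblocking C c ->
  run_upto C c n r -> dfa_run r n \notin final D ->
  ((prefix_cost r n)%:E <= value C c phi)%E.
Proof.
move=> nb run_r nfin; apply: value_ge => // k lt_kn.
by apply: contra nfin; apply: dfa_run_final_le.
Qed.

(* The weight of the last move of a belief path is the cost of a mode entered
   only after the good prefix is complete; replacing that mode by a cheapest
   one [m0] makes the two notions of cost differ by the constant [cost m0]. *)
Lemma strategy_wins (C : strategy N) (c : config N) (m0 : mode N) (v : R) :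
  (forall m : mode N, cost m0 <= cost m) -> nonblocking C c -> satisfies C c phi ->
  value C c phi = v%:E ->
  forall r n, run_upto C c n r -> ~~ (belief_run C c r n \subset paccept N D) ->
  wins (@legal R AP N D) (belief_run C c r n) (v + cost m0 - prefix_cost r n).
Proof.
move=> m0_min nb C_sat val_v; have [h hP] := satisfies_horizon C_sat.
move=> r n; have [k] := ubnP (h - n)%N; elim: k r n => // k IHk r n lt_k run_r.
move=> /fintype.subsetPn[p p_in]; rewrite inE => p_nfin.
have [r1 [run_r1 eq_r1 r1p]] := belief_run_realized run_r p_in.
rewrite -r1p /= in p_nfin.
have lt_nh : (n < h)%N.
  by rewrite ltnNge; apply: contra p_nfin; apply: hP.
have le_v : prefix_cost r n <= v.
  by rewrite -lee_fin -val_v -(eq_prefix_cost run_r1 run_r eq_r1) value_ge_nonfinal.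
set b := belief_run C c r n; set am := C (obs_upto r n).
have b_bel : b \in belief N D by apply: belief_run_belief.
have [p1 p1_in] : exists p1, p1 \in Post b am.1.
  have [s s_next] := nb _ _ run_r.1 run_r.2.
  exists (s, delta (dfa_run r n) (label (r n).1)); apply/bigcupP.
  exists (product_run r n); first exact: mem_belief_run.
  by apply/imsetP; exists s.
(* Nonemptiness of [Post] does not involve the mode, so the mode may be replaced freely. *)
have am_legal m : legal b (am.1, m).
  split=> //; apply/finset.set0Pn; exists (observe b (am.1, m) (gamma m p1.1)).
  apply/mem_btransP; eexists; first by [].
  by apply/finset.set0Pn; exists p1; apply: mem_observe.
have acc b' am' o : b' = observe b am' o -> b' != finset.set0 ->
    b' \subset paccept N D -> b' \in baccept N D.
  by move=> -> ne sub; rewrite inE observe_belief.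
have [Post_acc|/fintype.subsetPn[p' p'_in]] :=
    boolP (Post b am.1 \subset paccept N D).
  (* All successors accept, whatever is observed: the cheapest mode is entered, and its cost cancels
     the extra [cost m0] in the budget. *)
  apply: (WinsMove (am := (am.1, m0))) => // b' /mem_btransP[o def_b' ne].
  apply: WinsAccept; last by rewrite /=; lra.
  apply: acc (def_b') ne _; apply: fintype.subset_trans Post_acc.
  by rewrite def_b'; apply/fintype.subsetP => q; rewrite inE => /andP[].
rewrite inE => p'_nfin.
(* Some actual run is still nonaccepted after this step, so the value of [C] already pays for the
   mode entered. *)
have [r2 [run_r2 r2p' cost_r2 _]] := belief_run_step run_r p'_in.
have le_v2 : prefix_cost r n + cost am.2 <= v.
  rewrite -cost_r2 -lee_fin -val_v; apply: value_ge_nonfinal => //.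
  by move: p'_nfin; rewrite -r2p'.
apply: (WinsMove (am := am)); first by rewrite [am]surjective_pairing.
move=> b' /mem_btransP[o def_b' ne].
have [b'_acc|b'_nacc] := boolP (b' \subset paccept N D).
  apply: WinsAccept; first exact: acc def_b' ne b'_acc.
  by have := cost_ge0 m0; lra.
have [q q_in] := finset.set0Pn _ ne.
move: q_in; rewrite def_b' inE => /andP[q_Post /eqP q_o].
(* The induction hypothesis needs a run of [C] whose belief is [b']; one is obtained through a
   member of [b']. *)
have [r3 [run_r3 _ cost_r3 bel_r3]] := belief_run_step run_r q_Post.
rewrite -/b -/am q_o -def_b' in bel_r3.
rewrite -def_b' -bel_r3 -addrA -opprD -cost_r3.
by apply: IHk => //; rewrite ?bel_r3 //; lia.
Qed.

(** Induction on the winning tree: each step of the run descends to the successor matching its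
    observation and spends the cost of the mode entered; at a leaf the automaton accepts. *)
Lemma wins_run (CB : bstrategy N D) (C : strategy N) (c : config N) r b v n :
  obtained_from CB C -> is_run C c r ->
  wins (fun b am => CB b = Some am) b v ->
  brun CB (mkseq (fun j => gamma (r j.+1).2 (r j.+1).1) n) = Some b ->
  product_run r n \in b ->
  exists2 k, dfa_run r k \in final D & prefix_cost r k <= prefix_cost r n + v.
Proof.
move=> C_CB run_r w; elim: w n => {b v}[b v acc v0|b am v CBb _ IH] n brun_b pb.
  move: acc; rewrite inE => /andP[_ /fintype.subsetP/(_ _ pb)]; rewrite inE => fin.
  by exists n => //; lra.
have C_am : C (obs_upto r n) = am.
  (* The initial observation is split off, since [brun] starts after it. *)
  rewrite /obs_upto /mkseq /= (iotaDl 1 0) -map_comp.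
  exact: C_CB brun_b CBb.
have step := run_r.2 n; have pb' := mem_observe_step pb step.
rewrite C_am in pb'.
set b' := observe _ _ _ in pb'.
have b'_ne : b' != finset.set0 by apply/finset.set0Pn; exists (product_run r n.+1).
have [|||k fin le_k] := IH b' _ n.+1.
- by apply/mem_btransP; eexists.
- move: brun_b; rewrite /brun mkseqS foldl_rcons => -> /=.
  by rewrite /bnext CBb -/b' (negPf b'_ne).
- exact: pb'.
exists k => //; move: le_k; rewrite prefix_costS.
by have [-> _] := step; rewrite C_am; lra.
Qed.

End Runs.

(** * Correctness and optimality of the obtained strategy *)

Theorem theorem1 (R : realType) (AP : Type) (N : mnts R AP)
    (m_init : mode N) (phi : scltl AP) (D : dfa AP)
    (D_good : forall u : seq (set AP), accepts D u <-> good_prefix phi u)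
    (CB : bstrategy N D) (CB_returned : alg_returns CB)
    (C : strategy N) (C_obtained : obtained_from CB C) :
  satisfies C (s_init N, m_init) phi /\
  forall C' : strategy N,
    nonblocking C' (s_init N, m_init) ->
    satisfies C' (s_init N, m_init) phi ->
    (value C (s_init N, m_init) phi <= value C' (s_init N, m_init) phi)%E.
Proof.
set c := (s_init N, m_init).
have [st [st_reach st_win CB_st]] := CB_returned.
have [v wtg_v] := alg_sound st_reach st_win; rewrite -CB_st => CB_wins.
have C_bound r : is_run C c r ->
    exists2 k, dfa_run D r k \in final D & prefix_cost r k <= cost m_init + v.
  move=> run_r; have r0 := run_r.1.
  have := wins_run (n := 0%N) C_obtained run_r CB_wins.
  rewrite prefix_cost0 r0; apply=> //.
  by rewrite inE /product_run r0.
split=> [r /C_bound[k /D_good/good_prefix_sat //]|C' C'_nb C'_sat].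
have init_upto : run_upto C' c 0 (fun=> c) by [].
have C'_init := value_ge D_good C'_nb init_upto.
rewrite prefix_cost0 /= in C'_init.
(* If [q_init] accepts, the one-letter prefix is good and costs [cost m_init], a lower bound for
   every competitor. Otherwise acceptance happens at a positive index. *)
have [init_fin|init_nfin] := boolP (q_init D \in final D).
  apply: ge_ereal_sup => _ [r run_r <-]; apply: le_trans (C'_init _) => //.
  apply: ge_ereal_inf; exists (prefix_cost r 0)%:E; last first.
    by rewrite prefix_cost0 run_r.1.
  exists 0%N => //; apply/(good_run_prefixE D_good).
  exact: dfa_run_final_le D_good _ 0%N 1%N _ init_fin.
have {}C'_init : ((cost m_init)%:E <= value C' c phi)%E by apply: C'_init.
case def_v' : (value C' c phi) C'_init => [v'| |] // _; last by rewrite leey.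
have [m0 m0_min] : exists m0 : mode N, forall m : mode N, cost m0 <= cost m.
  case: (arg_minP (P := xpredT) (@cost _ _ N) (i0 := m_init)) => // m0 _ le_m0.
  by exists m0 => m; apply: le_m0.
have := strategy_wins D_good m0_min C'_nb C'_sat def_v' init_upto.
rewrite prefix_cost0 /= => /(_ _)/(alg_optimal st_reach st_win).
rewrite wtg_v lee_fin => le_v.
have {}le_v : v <= v' + cost m0 - cost m_init.
  by apply: le_v; apply/fintype.subsetPn; exists (c.1, q_init D); rewrite inE.
apply: ge_ereal_sup => _ [r run_r <-].
(* Acceptance at [k.+1] means a good prefix ending at [k]; the unpaid mode at [k.+1] costs at least
   [cost m0], which absorbs the shift. *)
have [[|k] fin le_k] := C_bound _ run_r.
  by rewrite /dfa_run /= (negPf init_nfin) in fin.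
apply: ge_ereal_inf; exists (prefix_cost r k)%:E.
  by exists k => //; apply/(good_run_prefixE D_good).
rewrite lee_fin; move: le_k; rewrite prefix_costS.
by have := m0_min (r k.+1).2; lra.
Qed.
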